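(* Let $\mu$ be any probability measure on $\mathbb{R}$ with a continuous strictly increasing cumulative distribution function $F$ such that for all $\varepsilon>0$ $$\limsup_{t\to\infty}\frac{1-F(t+\varepsilon)}{1-F(t)}<1\qquad\text{and}\qquad\limsup_{t\to-\infty}\frac{F(t)}{F(t+\varepsilon)}<1.$$ Let $(\omega_n)_{n=1}^{\infty}$ be any sequence in $\mathbb{N}$ with $\lim_{n\to\infty}\omega_n=\infty$. Then there exists a sequence $(\delta_n)_{n=1}^{\infty}$ with $\lim_{n\to\infty}\delta_n=0$ such that for all $n\in\mathbb{N}$, if $(x_i)_{i=1}^n$ is an i.i.d. sample from $\mu$ with corresponding order statistics $(x_{(i)})_{i=1}^n$, then with probability at least $1-\delta_n$, $$\sup_{\omega_n\le i\le n-\omega_n}|x_{(i)}-x_{(i)}^{*}|\le\delta_n,$$ where $x_{(i)}^{*}=F^{-1}(i/(n+1))$.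
   Context: $\mathbb{N}=\{1,2,3,\dots\}$. The order statistics $x_{(1)}\le x_{(2)}\le\dots\le x_{(n)}$ are the sample values arranged in non-decreasing order. $F$ is strictly increasing on all of $\mathbb{R}$, and $F^{-1}:(0,1)\to\mathbb{R}$ is its inverse function. The supremum is over integers $i$; if there is no integer $i$ with $\omega_n\le i\le n-\omega_n$, the inequality is regarded as vacuously true. *)

(* Defs.v *)
From HB Require Import structures.
From mathcomp Require Import all_boot all_order all_algebra.
From mathcomp Require Import all_classical all_reals all_analysis.

Set Implicit Arguments.
Unset Strict Implicit.
Unset Printing Implicit Defensive.

Import Order.TTheory GRing.Theory Num.Theory.
Import numFieldNormedType.Exports.

Local Open Scope classical_set_scope.
Local Open Scope ring_scope.

Definition law_cdf (R : realType) (mu : probability R R) (t : R) : R :=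
  fine (mu `]-oo, t]%classic).

(* [pinv setT F p] is a preimage of [p] under [F := law_cdf mu] when it has one;
   when [F] is continuous and strictly increasing this is the inverse
   ]0, 1[ -> R of [F], and the default value taken outside ]0, 1[ carries no
   meaning. *)
Definition law_quantile (R : realType) (mu : probability R R) : R -> R :=
  pinv [set: R] (law_cdf mu).

Definition mutually_independent (R : realType) d (T : measurableType d)
    (P : probability T R) (I : finType) (X : I -> {RV P >-> R}) : Prop :=
  forall (J : {set I}) (B : I -> set R), (forall i, measurable (B i)) ->
    P (\bigcap_(i in [set` J]) X i @^-1` B i) =
    (\prod_(i in J) P (X i @^-1` B i))%E.

(* Laws are compared on Borel sets only, since the value of a [probability] on
   a non-measurable set is unspecified. *)
Definition iid_sample (R : realType) (mu : probability R R) d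
    (T : measurableType d) (P : probability T R) (n : nat)
    (X : 'I_n -> {RV P >-> R}) : Prop :=
  mutually_independent X /\
  forall (i : 'I_n) (B : set R), measurable B -> distribution P (X i) B = mu B.

(* [i] counts from 1, as in x_(1) <= ... <= x_(n); only 1 <= i <= n matters. *)
Definition order_stat (R : realType) (n : nat) (x : 'I_n -> R) (i : nat) : R :=
  nth 0 (sort <=%R (codom x)) i.-1.

(* Main.v *)
Require Import Defs.
From HB Require Import structures.
From mathcomp Require Import all_boot all_order all_algebra.
From mathcomp Require Import all_classical all_reals all_analysis.
From mathcomp Require Import lra ring zify.

(** Fix eps > 0.  The tail conditions and compactness give k > 0 with
    F(t + eps) - F(t) >= k F(t + eps) (1 - F(t)) for all t.  With p = i/(n+1)
    and q = F^-1(p), x_(i) < q - eps means that at least i sample points lie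
    below q - eps, an event of probability at most p - k p (1 - p) for each of
    them; symmetrically, x_(i) > q + eps means that at least n + 1 - i points
    lie above q + eps, an event of probability at most
    (1 - p) - k p (1 - p).  A Chernoff bound makes both probabilities at most
    exp(- c (n + 1) p (1 - p)), which decays geometrically in min(i, n + 1 - i),
    so the union bound over omega_n <= i <= n - omega_n is a geometric tail
    O(r ^ omega_n), uniformly over the samples.  Letting eps tend to 0 slowly
    with n gives delta. *)

Set Implicit Arguments.
Unset Strict Implicit.
Unset Printing Implicit Defensive.

Import Order.TTheory GRing.Theory Num.Theory.
Import numFieldNormedType.Exports.

Local Open Scope classical_set_scope.
Local Open Scope ring_scope.

(** * Analytic form of the Chernoff bound *)

(** Taking reciprocals, this is 1 + y <= exp(y) at y = 2x^2 - x, because (1 + x)(1 + y) = 1 + x^2 (1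
    + 2x) >= 1. *)
Lemma expR_le1Dx (R : realType) (x : R) : - (1 / 2) <= x ->
  expR (x - 2 * x ^+ 2) <= 1 + x.
Proof.
move=> x_ge.
have x1_gt0 : 0 < 1 + x by lra.
have : 1 + (2 * x ^+ 2 - x) <= expR (2 * x ^+ 2 - x) by exact: expR_ge1Dx.
have -> : x - 2 * x ^+ 2 = - (2 * x ^+ 2 - x) by ring.
rewrite expRN => E_ge.
have E_gt0 := expR_gt0 (2 * x ^+ 2 - x).
rewrite -[leLHS]mul1r ler_pdivrMr//.
apply: (@le_trans _ _ ((1 + x) * (1 + (2 * x ^+ 2 - x)))).
  have -> : (1 + x) * (1 + (2 * x ^+ 2 - x)) = 1 + x ^+ 2 * (1 + 2 * x) by ring.
  by rewrite lerDl mulr_ge0 ?sqr_ge0//; lra.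
by rewrite ler_pM2l.
Qed.


(* The weights [u >= v] have mean 1 under the Bernoulli law of parameter
   [p = m / (n + 1)], so the linear terms of [ln u] and [ln v] cancel. *)
Lemma weighted_binomial_bound (R : realType) (n m : nat) (a s : R) :
    let p := m%:R / n.+1%:R in
    let u := 1 + s * (1 - p) in let v := 1 - s * p in
    (0 < n)%N -> (m <= n)%N -> 0 < s <= 1 / 2 -> 0 <= a ->
    a <= p - 8 * s * (p * (1 - p)) ->
  (a * u + (1 - a) * v) ^+ n / (u ^+ m * v ^+ (n - m)) <=
    expR (- (n.+1%:R * s ^+ 2 * (p * (1 - p)))).
Proof.
move=> p u v n_gt0 m_le /andP[s_gt0 s_le] a_ge0 a_le.
have n1_gt0 : 0 < n.+1%:R :> R by rewrite ltr0n.
have p_ge0 : 0 <= p by rewrite /p divr_ge0.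
have p_lt1 : p < 1 by rewrite /p ltr_pdivrMr// mul1r ltr_nat ltnS.
have mE : m%:R = n.+1%:R * p by rewrite /p mulrC divfK// gt_eqF.
(* Since p has denominator n + 1, the exponent n - m falls one short of (n + 1)(1 - p). *)
have nmE : (n - m)%:R = n.+1%:R * (1 - p) - 1 :> R.
  by rewrite mulrBr -mE natrB// -(addn1 n) natrD; ring.
have sp_ge0 : 0 <= s * p by nra.
have sp_le : s * p <= 1 / 2 by nra.
have sq_ge0 : 0 <= s * (1 - p) by nra.
have u_ge : expR (s * (1 - p) - 2 * (s * (1 - p)) ^+ 2) <= u.
  by apply: expR_le1Dx; lra.
have v_ge : expR (- (s * p) - 2 * (s * p) ^+ 2) <= v.
  by rewrite -[(s * p) ^+ 2]sqrrN; apply: expR_le1Dx; lra.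
have n_le : n.+1%:R <= 2 * n%:R :> R.
  by rewrite -natrM ler_nat mul2n -addnn -addn1 leq_add2l.
have u_gt0 : 0 < u by rewrite /u; lra.
have v_gt0 : 0 < v by rewrite /v; lra.
have v_le1 : v <= 1 by rewrite /v; lra.
have pq_ge0 : 0 <= p * (1 - p) by nra.
have num_le : (a * u + (1 - a) * v) ^+ n <=
    expR (- (8 * s ^+ 2 * (p * (1 - p))) * n%:R).
  rewrite expRM_natr lerXn2r ?nnegrE ?expR_ge0//.
    by rewrite addr_ge0 ?mulr_ge0 ?(ltW u_gt0) ?(ltW v_gt0)//; nra.
  apply: le_trans (expR_ge1Dx _).
  have -> : a * u + (1 - a) * v = 1 + s * (a - p) by rewrite /u /v; ring.
  by rewrite lerD2l; nra.
(* One extra factor [v <= 1] raises the exponent of [v] to (n + 1)(1 - p); the linear terms then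
   cancel exactly and only the quadratic ones remain. *)
have den_ge : expR (- (n.+1%:R * (2 * s ^+ 2 * (p * (1 - p))))) <=
    u ^+ m * v ^+ (n - m).
  have -> : - (n.+1%:R * (2 * s ^+ 2 * (p * (1 - p)))) =
     (s * (1 - p) - 2 * (s * (1 - p)) ^+ 2) * m%:R +
     (- (s * p) - 2 * (s * p) ^+ 2) * (n - m).+1%:R.
    by rewrite mE -[(n - m).+1]addn1 natrD nmE; ring.
  rewrite expRD 2!expRM_natr ler_pM ?exprn_ge0 ?expR_ge0//.
    by rewrite lerXn2r ?nnegrE ?expR_ge0 ?(ltW u_gt0).
  apply: (@le_trans _ _ (v ^+ (n - m).+1)).
    by rewrite lerXn2r ?nnegrE ?expR_ge0 ?(ltW v_gt0).
  by rewrite exprS ger_pMl// exprn_gt0.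
rewrite ler_pdivrMr; last by rewrite mulr_gt0// exprn_gt0.
apply: le_trans num_le _.
apply: le_trans (ler_wpM2l (expR_ge0 _) den_ge).
rewrite -expRD ler_expR.
have s2_ge0 : 0 <= s ^+ 2 * (p * (1 - p)) by rewrite mulr_ge0// sqr_ge0.
(* By n + 1 <= 2n the numerator contributes at most -4 (n + 1) s^2 p (1 - p) to the exponent, and
   the denominator takes back 2 of these 4. *)
nra.
Qed.

Lemma probability_bigsetU_le (R : realType) d (T : measurableType d)
    (P : probability T R) (I : Type) (r : seq I) (Q : pred I) (F : I -> set T) :
  (forall i, measurable (F i)) ->
  (P (\big[setU/set0]_(i <- r | Q i) F i) <= \sum_(i <- r | Q i) P (F i))%E.
Proof.
move=> mF; elim: r => [|i r IHr]; first by rewrite !big_nil measure0.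
rewrite !big_cons; case: ifP => // _.
apply: le_trans (leeD2l _ IHr).
by apply: measureU2 => //; exact: bigsetU_measurable.
Qed.

(** * Order statistics expressed by counts of sample points *)

Section order_statistics.
Context (R : realType) (n : nat) (x : 'I_n -> R).

Let s := sort <=%R (codom x).

Let s_sorted : sorted <=%R s. Proof. exact: sort_le_sorted. Qed.

Let size_s : size s = n. Proof. by rewrite size_sort size_codom card_ord. Qed.

Let count_s (a : pred R) : count a s = #|[set j | a (x j)]%SET|.
Proof.
rewrite count_sort count_map cardE size_filter enumT.
by apply: eq_count => j /=; rewrite inE.
Qed.

(** The entries below t form a prefix of the sorted sample, so the entry at index i - 1 is among
    them exactly when the prefix has length at least i. *)
Lemma order_stat_ltE (i : nat) (t : R) : (0 < i <= n)%N ->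
  (order_stat x i < t) = (i <= #|[set j | (x j < t)%R]%SET|)%N.
Proof.
case: i => // i /= i_lt; rewrite -(count_s (< t)%O); apply/idP/idP.
  apply: contraTT; rewrite -ltnNge ltnS -leNgt => c_le.
  by apply: nth_count_ge => //; rewrite c_le size_s.
exact: nth_count_lt.
Qed.

Lemma order_stat_gtE (i : nat) (t : R) : (0 < i <= n)%N ->
  (t < order_stat x i) = (n - i < #|[set j | (t < x j)%R]%SET|)%N.
Proof.
case: i => // i /= i_lt; rewrite -(count_s (> t)%O).
(* Passage to the complementary count; the local [i] is the original index minus one. *)
have -> : (n - i.+1 < count (> t)%O s)%N = (count (<= t)%O s <= i)%N.
  rewrite count_le_gt size_s; have := count_size (> t)%O s.
  by rewrite size_s; move: (count _ _) => c c_le; apply/idP/idP; lia.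
apply/idP/idP => [|c_le].
  by apply: contraTT; rewrite -ltnNge -leNgt; exact: nth_count_le.
by apply: nth_count_gt => //; rewrite c_le size_s.
Qed.

End order_statistics.

(** * Binomial tail bound for the number of sample points in a Borel set *)

Section count_sample.
Context (R : realType) (mu : probability R R).
Context (d : measure_display) (T : measurableType d) (P : probability T R).
Context (n : nat) (X : 'I_n -> {RV P >-> R}).

(** The index set is recorded rather than its size: that it equals a given [J] is an intersection of
    coordinate events, whose probability independence turns into a product. *)
Definition hits (B : set R) (w : T) : {set 'I_n} := [set j | X j w \in B]%SET.

Lemma hitsE (B : set R) (J : {set 'I_n}) :
  [set w | hits B w = J] =
  \bigcap_(j in [set` [set: 'I_n]%SET]) X j @^-1` (if j \in J then B else ~` B).
Proof.
apply/seteqP; split=> w /=.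
  move=> <- j _ /=; rewrite /hits inE.
  by case: ifPn => [/set_mem//|/negP jB Bj]; apply: jB; exact/mem_set.
move=> wJ; apply/setP => j; rewrite /hits inE.
have := wJ j; rewrite /= finset.in_setT => /(_ isT).
by case: ifP => [_ /mem_set ->//|_ /= Bj]; apply/negbTE/negP => /set_mem.
Qed.

Lemma measurable_hits_eq (B : set R) (J : {set 'I_n}) :
  measurable B -> measurable [set w | hits B w = J].
Proof.
move=> mB; rewrite hitsE; apply: fin_bigcap_measurable => [|j _].
  exact: finite_finset.
apply: measurable_funPTI.
by case: ifP => _ //; exact: measurableC.
Qed.

Lemma hits_geE (B : set R) (m : nat) :
  [set w | (m <= #|hits B w|)%N] =
  \big[setU/set0]_(J : {set 'I_n} | (m <= #|J|)%N) [set w | hits B w = J].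
Proof.
rewrite -(bigcup_pred (fun J : {set 'I_n} => (m <= #|J|)%N)).
by apply/seteqP; split=> [w mw|w [J /= mJ wJ]]; [exists (hits B w) | rewrite wJ].
Qed.

Lemma measurable_hits_ge (B : set R) (m : nat) :
  measurable B -> measurable [set w | (m <= #|hits B w|)%N].
Proof.
move=> mB; rewrite hits_geE; apply: bigsetU_measurable => J _.
exact: measurable_hits_eq.
Qed.

Lemma probability_hits_eq (B : set R) (J : {set 'I_n}) : iid_sample mu X ->
  measurable B -> P [set w | hits B w = J] =
  (\prod_(j < n) if j \in J then fine (mu B) else 1 - fine (mu B))%:E.
Proof.
move=> [indep law] mB; rewrite hitsE indep; last first.
  by move=> j; case: ifP => _ //; exact: measurableC.
rewrite -prodEFin; apply: eq_big => [j|j _]; first by rewrite finset.in_setT.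
transitivity (distribution P (X j) (if j \in J then B else ~` B)) => //.
rewrite law; last by case: ifP => _ //; exact: measurableC.
case: ifP => _; first by rewrite fineK ?fin_num_measure.
by rewrite probability_setC// EFinB fineK ?fin_num_measure.
Qed.

(** Exponential Markov inequality: weigh each hit by [u] and each miss by [v]. As [v <= u], every
    outcome with at least m hits has weight at least u^m v^(n - m), while the mean total weight is
    (a u + (1 - a) v)^n. *)
Lemma probability_hits_ge (B : set R) (m : nat) (s : R) :
    let p := m%:R / n.+1%:R in
    iid_sample mu X -> measurable B -> (0 < n)%N -> (m <= n)%N ->
    0 < s <= 1 / 2 -> fine (mu B) <= p - 8 * s * (p * (1 - p)) ->
  (P [set w | (m <= #|hits B w|)%N] <=
    (expR (- (n.+1%:R * s ^+ 2 * (p * (1 - p)))))%:E)%E.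
Proof.
move=> p iidX mB n_gt0 m_le s01 muB_le.
set a := fine (mu B) in muB_le *.
have a_ge0 : 0 <= a by exact: fine_ge0.
have muB : mu B = a%:E by rewrite fineK ?fin_num_measure.
have a_le1 : a <= 1 by rewrite -lee_fin -muB probability_le1.
have := weighted_binomial_bound n_gt0 m_le s01 a_ge0 muB_le; rewrite -/p.
set u := 1 + s * (1 - p); set v := 1 - s * p.
have p_ge0 : 0 <= p by rewrite /p divr_ge0.
have p_lt1 : p < 1 by rewrite /p ltr_pdivrMr ?ltr0n// mul1r ltr_nat ltnS.
have v_gt0 : 0 < v by rewrite /v; move/andP: s01; nra.
have vu : v <= u by rewrite /u /v; move/andP: s01; lra.
have u_gt0 : 0 < u := lt_le_trans v_gt0 vu.
have uv_gt0 : 0 < u ^+ m * v ^+ (n - m) by rewrite mulr_gt0 ?exprn_gt0.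
rewrite -lee_fin => /(le_trans _); apply; rewrite hits_geE.
have mJ J := measurable_hits_eq J mB.
apply: le_trans (probability_bigsetU_le P _ _ mJ) _.
under eq_bigr do rewrite (probability_hits_eq _ iidX mB).
rewrite sumEFin lee_fin -/a ler_pdivlMr//.
(* Expanding the power over subsets [J] makes it the weighted sum over all outcomes; those with
   fewer than m hits are then dropped. *)
have -> : (a * u + (1 - a) * v) ^+ n =
    \sum_(J : {set 'I_n}) \prod_(j < n) if j \in J then a * u else (1 - a) * v.
  by rewrite -bigA_distr prodr_const card_ord.
rewrite mulr_suml [leRHS](bigID (fun J : {set 'I_n} => (m <= #|J|)%N)) /=.
have prod_ge0 (J : {set 'I_n}) (b c : R) : 0 <= b -> 0 <= c ->
    0 <= \prod_(j < n) if j \in J then b else c.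
  by move=> b0 c0; apply: prodr_ge0 => j _; case: ifP.
rewrite -[leLHS]addr0 lerD//; last first.
  apply: sumr_ge0 => J _; apply: prod_ge0;
  by rewrite mulr_ge0 ?(ltW u_gt0) ?(ltW v_gt0)//; lra.
apply: ler_sum => J m_leJ.
have prodE (b c : R) : \prod_(j < n) (if j \in J then b else c) =
    b ^+ #|J| * c ^+ (n - #|J|).
  rewrite (bigID (mem J)) /= (eq_bigr (fun=> b)) => [|j ->//].
  rewrite prodr_const (eq_bigr (fun=> c)) => [|j /negbTE -> //].
  rewrite !prodr_const; congr (_ * _ ^+ _).
  by apply/esym/(canLR (addKn _)); rewrite cardC card_ord.
rewrite !prodE !exprMn [leRHS]mulrACA ler_wpM2l//.
  by rewrite mulr_ge0 ?exprn_ge0//; lra.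
have J_le : (#|J| <= n)%N by rewrite -[leqRHS]card_ord max_card.
(* The [#|J| - m] surplus factors are [u] on one side and [v <= u] on the other. *)
rewrite -(subnK m_leJ) addnC exprD -mulrA ler_wpM2l ?exprn_ge0 ?(ltW u_gt0)//.
have -> : (n - m = #|J| - m + (n - (m + (#|J| - m))))%N by lia.
rewrite exprD ler_wpM2r ?exprn_ge0 ?(ltW v_gt0)//.
by rewrite lerXn2r// nnegrE ltW.
Qed.

End count_sample.

(** * Limsup bounds, quantiles and increments of the distribution function *)

Lemma limf_esup_lt_near (R : realType) (g : R -> R) (F : set_system R)
    (b : R) : Filter F ->
  (limf_esup (fun t => (g t)%:E) F < b%:E)%E ->
  exists2 c, c < b & \forall t \near F, g t <= c.
Proof.
move=> FF /ereal_inf_lt[y [V FV <-{y}] sup_lt].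
have V_le t : V t -> ((g t)%:E <= ereal_sup [set (g t)%:E | t in V])%E.
  by move=> Vt; apply: ereal_sup_ubound; exists t.
case: (ereal_sup _) sup_lt V_le => [c c_lt V_le|//|_ V_le].
  by exists c => //; apply: filterS FV => t /V_le; rewrite lee_fin.
(* A supremum equal to -oo leaves [V] empty, so any bound below b serves. *)
by exists (b - 1); [rewrite gtrBl | apply: filterS FV => t /V_le].
Qed.

Section law_cdf_facts.
Context (R : realType) (mu : probability R R).

Local Notation F := (law_cdf mu).

Lemma law_cdfE (t : R) : (F t)%:E = mu `]-oo, t]%classic.
Proof. by rewrite fineK// fin_num_measure. Qed.

Lemma law_cdf_ge0 (t : R) : 0 <= F t.
Proof. exact: fine_ge0. Qed.

Lemma law_cdf_le1 (t : R) : F t <= 1.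
Proof. by rewrite -lee_fin law_cdfE probability_le1. Qed.

Lemma fine_law_ray_lt (t : R) : fine (mu `]-oo, t[%classic) <= F t.
Proof.
apply: fine_le; rewrite ?fin_num_measure//.
by apply: le_measure; rewrite ?inE//; apply: subset_itvl; rewrite bnd_simp.
Qed.

Lemma fine_law_ray_gt (t : R) : fine (mu `]t, +oo[%classic) = 1 - F t.
Proof. by rewrite -setCitvl probability_setC// -law_cdfE. Qed.

Hypothesis F_continuous : continuous F.
Hypothesis F_increasing : {homo F : s t / s < t}.

Lemma law_cdf_gt0 (t : R) : 0 < F t.
Proof.
by apply: le_lt_trans (law_cdf_ge0 (t - 1)) (F_increasing _); rewrite gtrBl.
Qed.

Lemma law_cdf_lt1 (t : R) : F t < 1.
Proof.
by apply: lt_le_trans (law_cdf_le1 (t + 1)); apply: F_increasing; rewrite ltrDl.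
Qed.

(** F tends to 0 and 1 at the two ends, so the intermediate value theorem provides a preimage of p,
    and [pinv] then returns one. *)
Lemma law_cdf_quantile (p : R) : 0 < p < 1 -> F (law_quantile mu p) = p.
Proof.
move=> /andP[p_gt0 p_lt1].
(* Under [mu] the identity has law [mu], so the limits known for the cdf of a random variable apply
   to F. *)
pose idRV : {RV mu >-> R} := mfun_Sub (mem_set (@measurable_id _ R setT)).
have cdfE : fine \o cdf idRV = F by [].
have F_Ny : F t @[t --> -oo] --> (0 : R).
  by rewrite -cdfE; apply: fine_cvg; exact: (cvg_cdfNy0 idRV).
have F_y : F t @[t --> +oo] --> (1 : R).
  by rewrite -cdfE; apply: fine_cvg; exact: (cvg_cdfy1 idRV).
have [a Fa] : exists a, F a < p.
  by apply: (@filter_ex _ (ninfty_nbhs R)); exact: cvgr_lt F_Ny _ p_gt0.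
have [b Fb] : exists b, p < F b.
  by apply: (@filter_ex _ (pinfty_nbhs R)); exact: cvgr_gt F_y _ p_lt1.
have ab : a <= b.
  rewrite leNgt; apply/negP => /F_increasing; rewrite ltNge => /negP; apply.
  exact/ltW/(lt_trans Fa).
have [|c _ Fc] := IVT (v := p) ab (continuous_subspaceT F_continuous).
  by rewrite ge_min le_max (ltW Fa) (ltW Fb) orbT.
by apply: pinvK; rewrite inE; exists c.
Qed.

(** Far right the increment is at least (1 - c1)(1 - F(t)), far left at least (1 - c2) F(t + eps),
    and on the compact middle at least its positive minimum c3. The product F(t + eps)(1 - F(t)) is
    at most each of its factors and at most 1, so the least of the three constants works. *)
Lemma law_cdf_increment (eps : R) : 0 < eps ->
    (limf_esup (fun t : R => ((1 - F (t + eps)) / (1 - F t))%:E) +oo%R < 1)%E ->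
    (limf_esup (fun t : R => (F t / F (t + eps))%:E) -oo%R < 1)%E ->
  exists2 k : R, 0 < k &
    forall t, k * (F (t + eps) * (1 - F t)) <= F (t + eps) - F t.
Proof.
move=> eps_gt0 /limf_esup_lt_near[c1 c1_lt [M1 [_ M1P]]].
move=> /limf_esup_lt_near[c2 c2_lt [M2 [_ M2P]]].
have F_lt t : F t < F (t + eps) by apply: F_increasing; rewrite ltrDl.
(* The thresholds of the two tails may come in either order. *)
pose a := Num.min M1 M2; pose b := Num.max M1 M2.
have ab : a <= b by rewrite ge_min !le_max lexx.
have shift_continuous : continuous (fun t : R => t + eps).
  by move=> t; apply: cvgD; [exact: cvg_id | exact: cvg_cst].
have increment_continuous : continuous (fun t => F (t + eps) - F t).
  move=> t; apply: cvgB; last exact: F_continuous.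
  by apply: (@continuous_comp _ _ _ (fun t => t + eps) F);
    [exact: shift_continuous | exact: F_continuous].
have [m _ mP] := EVT_min ab (continuous_subspaceT increment_continuous).
set c3 := F (m + eps) - F m in mP.
have c3_gt0 : 0 < c3 by rewrite subr_gt0.
pose k := Num.min c3 (Num.min (1 - c1) (1 - c2)).
have k3 : k <= c3 by rewrite ge_min lexx.
have k1 : k <= 1 - c1 by rewrite !ge_min lexx orbT.
have k2 : k <= 1 - c2 by rewrite !ge_min lexx !orbT.
exists k; first by rewrite !lt_min c3_gt0 !subr_gt0 c1_lt c2_lt.
have k_ge0 : 0 <= k by rewrite !le_min (ltW c3_gt0) !subr_ge0 !ltW.
move=> t.
have Fe0 := law_cdf_gt0 (t + eps); have Fe1 := law_cdf_lt1 (t + eps).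
have F0 := law_cdf_gt0 t; have F1 := law_cdf_lt1 t.
have G0 : 0 < 1 - F t by rewrite subr_gt0.
have [tM1|tM1] := ltP M1 t.
  have := M1P _ tM1; rewrite ler_pdivrMr// => h.
  have h1 : k * (1 - F t) <= (1 - c1) * (1 - F t) by rewrite ler_pM2r.
  have h2 : k * (F (t + eps) * (1 - F t)) <= k * (1 - F t).
    by rewrite ler_wpM2l// ger_pMl// ltW.
  lra.
have [tM2|tM2] := ltP t M2.
  have := M2P _ tM2; rewrite ler_pdivrMr// => h.
  have h1 : k * F (t + eps) <= (1 - c2) * F (t + eps) by rewrite ler_pM2r.
  have h2 : k * (F (t + eps) * (1 - F t)) <= k * F (t + eps).
    by rewrite ler_wpM2l// ger_pMr//; lra.
  lra.
have := mP t; rewrite in_itv/= ge_min tM2 le_max tM1 !orbT => /(_ isT) h.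
have h1 : 0 <= F (t + eps) * (1 - F t).
  by rewrite mulr_ge0 ?(ltW Fe0) ?(ltW G0).
have h2 : F (t + eps) * (1 - F t) <= 1.
  by rewrite mulr_ile1 ?(ltW G0) ?(ltW Fe0) ?(ltW Fe1)//; lra.
by apply: le_trans h; rewrite -[leRHS]mulr1 ler_pM.
Qed.

End law_cdf_facts.

(** * Geometric decay in the distance of the index from the ends *)

Lemma sum_geometric_le (R : realType) (r : R) (a b : nat) : 0 <= r < 1 ->
  \sum_(a <= i < b) r ^+ i <= r ^+ a / (1 - r).
Proof.
move=> /andP[r_ge0 r_lt1]; have r1 : 0 < 1 - r by rewrite subr_gt0.
rewrite ler_pdivlMr//; have [ba|/ltnW ab] := leqP b a.
  by rewrite big_geq// mul0r exprn_ge0.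
suff -> : (\sum_(a <= i < b) r ^+ i) * (1 - r) = r ^+ a - r ^+ b.
  by rewrite gerBl exprn_ge0.
have /= tele := telescope_sumr (fun i => r ^+ i) ab.
rewrite -[RHS]opprB -tele -sumrN mulr_suml.
by apply: eq_bigr => i _; rewrite exprS; ring.
Qed.

(** One of p and 1 - p is at least 1/2, so (n + 1) p (1 - p) >= min(i, n + 1 - i) / 2. Bounding by
    the sum of both powers leaves two plain geometric series. *)
Lemma expR_variance_le (R : realType) (n i : nat) (c : R) :
    let p := i%:R / n.+1%:R in 0 <= c -> (i <= n.+1)%N ->
  expR (- (n.+1%:R * c * (p * (1 - p)))) <=
    expR (- (c / 2)) ^+ i + expR (- (c / 2)) ^+ (n.+1 - i).
Proof.
move=> p c_ge0 i_le.
have n1_gt0 : 0 < n.+1%:R :> R by rewrite ltr0n.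
have iE : i%:R = n.+1%:R * p by rewrite /p mulrC divfK// gt_eqF.
have p_ge0 : 0 <= p by rewrite /p divr_ge0.
have p_le1 : p <= 1 by rewrite /p ler_pdivrMr// mul1r ler_nat.
have r_ge0 m : 0 <= expR (- (c / 2)) ^+ m by rewrite exprn_ge0// expR_ge0.
have x_ge0 : 0 <= n.+1%:R * c by rewrite mulr_ge0.
have [p_le|p_ge] := leP p (1 / 2).
  apply: le_trans (_ : _ <= expR (- (c / 2)) ^+ i) _; last by rewrite lerDl.
  rewrite -expRM_natr ler_expR iE.
  have h : n.+1%:R * c * (p * (1 / 2)) <= n.+1%:R * c * (p * (1 - p)).
    by rewrite ler_wpM2l// ler_wpM2l//; lra.
  lra.
apply: le_trans (_ : _ <= expR (- (c / 2)) ^+ (n.+1 - i)) _;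
  last by rewrite lerDr.
rewrite -expRM_natr ler_expR natrB// iE.
have h : n.+1%:R * c * ((1 - p) * (1 / 2)) <= n.+1%:R * c * ((1 - p) * p).
  by rewrite ler_wpM2l// ler_wpM2l//; lra.
lra.
Qed.

(** * Deviation of a single order statistic from its quantile *)

Section deviation.
Context (R : realType) (mu : probability R R).
Local Notation F := (law_cdf mu).
Local Notation Q := (law_quantile mu).

Hypothesis F_continuous : continuous F.
Hypothesis F_increasing : {homo F : s t / s < t}.

(** For 1 <= i <= n this says that x_(i) lies outside [q - e, q + e], where q = F^-1(i/(n + 1)).
    Stating it by counts gives access to the binomial tail bound. *)
Definition deviation_event d (T : measurableType d) (P : probability T R)
    (n : nat) (X : 'I_n -> {RV P >-> R}) (e : R) (i : nat) : set T :=
  [set w | (i <= #|hits X `]-oo, (Q (i%:R / n.+1%:R) - e)%R[%classic w|)%N] `|`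
  [set w | (n.+1 - i <= #|hits X `](Q (i%:R / n.+1%:R) + e)%R, +oo[%classic w|)%N].

(** The supremum is at most e exactly when every term is; for an empty range it is -oo and the event
    is everything. With [a] positive, every index in the range lies in 1..n. *)
Lemma deviation_eventE d (T : measurableType d) (P : probability T R)
    (n : nat) (X : 'I_n -> {RV P >-> R}) (e : R) (a : nat) : (0 < a)%N ->
  [set w | (ereal_sup
             [set `|order_stat (fun j => X j w) i - Q (i%:R / n.+1%:R)|%:E
               | i in [set i | (a <= i <= n - a)%N]]
           <= e%:E)%E] =
  ~` \big[setU/set0]_(a <= i < (n - a).+1) deviation_event X e i.
Proof.
move=> a_gt0; rewrite -bigcup_seq setC_bigcup.
have in_range i : (i \in index_iota a (n - a).+1) = (a <= i <= n - a)%N.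
  by rewrite mem_index_iota ltnS.
have devE w i : (a <= i <= n - a)%N -> (~` deviation_event X e i) w <->
    `|order_stat (fun j => X j w) i - Q (i%:R / n.+1%:R)| <= e.
  move=> i_range; have i_le : (0 < i <= n)%N by lia.
  have -> : (~` deviation_event X e i) w <->
      ~ (order_stat (fun j => X j w) i < Q (i%:R / n.+1%:R) - e \/
        Q (i%:R / n.+1%:R) + e < order_stat (fun j => X j w) i).
    (* For i <= n, having more than n - i points is having at least n + 1 - i, the form used in
       [deviation_event]. *)
    rewrite order_stat_ltE// order_stat_gtE// -subSn; last by case/andP: i_le.
    rewrite /deviation_event /=.
    have -> t : hits X `]-oo, t[%classic w = [set j | (X j w < t)%R]%SET.
      by apply/setP => j; rewrite !finset.inE mem_setE in_itv.
    have -> t : hits X `]t, +oo[%classic w = [set j | (t < X j w)%R]%SET.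
      by apply/setP => j; rewrite !finset.inE mem_setE in_itv/= andbT.
    by [].
  rewrite not_orP ler_distl !leNgt.
  by split => [[/negP -> /negP ->]//|/andP[/negP ? /negP ?]//].
apply/seteqP; split=> w /=.
  move=> sup_le i; rewrite /= in_range => i_range; apply/devE => //.
  by rewrite -lee_fin; apply: le_trans sup_le; apply: ereal_sup_ubound; exists i.
move=> dev; apply: ge_ereal_sup => _ [i /= i_range <-].
by rewrite lee_fin; apply/devE => //; apply: dev; rewrite /= in_range.
Qed.

Lemma measurable_deviation_event d (T : measurableType d) (P : probability T R)
    (n : nat) (X : 'I_n -> {RV P >-> R}) (e : R) (i : nat) :
  measurable (deviation_event X e i).
Proof. by apply: measurableU; exact: measurable_hits_ge. Qed.

(** The increment bound at t = q - e gives F(q - e) <= p - 8 s p (1 - p), and at t = q it gives 1 -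
    F(q + e) <= (1 - p) - 8 s p (1 - p). The tail bound then applies with m = i and m = n + 1 -
    i. *)
Lemma probability_deviation_event d (T : measurableType d) (P : probability T R)
    (n : nat) (X : 'I_n -> {RV P >-> R}) (e s : R) (i : nat) :
    let p := i%:R / n.+1%:R in
    iid_sample mu X -> (0 < i <= n)%N -> 0 < e -> 0 < s <= 1 / 2 ->
    (forall t, 8 * s * (F (t + e) * (1 - F t)) <= F (t + e) - F t) ->
  (P (deviation_event X e i) <=
    (2 * expR (- (n.+1%:R * s ^+ 2 * (p * (1 - p)))))%:E)%E.
Proof.
move=> p iidX /andP[i_gt0 i_le] e_gt0 s01 incr.
have n_gt0 : (0 < n)%N by exact: leq_trans i_le.
have n1_gt0 : 0 < n.+1%:R :> R by rewrite ltr0n.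
have p_gt0 : 0 < p by rewrite /p divr_gt0// ltr0n.
have p_lt1 : p < 1 by rewrite /p ltr_pdivrMr// mul1r ltr_nat ltnS.
have FQ : F (Q p) = p by apply: law_cdf_quantile => //; rewrite p_gt0.
have qE : (n.+1 - i)%:R / n.+1%:R = 1 - p.
  by rewrite natrB ?(leqW i_le)// mulrBl divff ?gt_eqF.
have s_ge0 : 0 <= 8 * s by case/andP: s01; lra.
rewrite mulr_natl mulr2n EFinD.
apply: (le_trans (measureU2 _ _ _)); try exact: measurable_hits_ge.
apply: leeD.
  apply: (probability_hits_ge iidX) => //.
  apply: (le_trans (fine_law_ray_lt mu _)).
  have := incr (Q p - e); rewrite subrK FQ.
  have Fq_le : F (Q p - e) <= p.
    by rewrite -[leRHS]FQ ltW// F_increasing// gtrBl.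
  have : 8 * s * (p * (1 - p)) <= 8 * s * (p * (1 - F (Q p - e))).
    by rewrite ler_wpM2l// ler_wpM2l ?(ltW p_gt0)// lerB.
  rewrite -/p; lra.
(* The variance is symmetric, so the upper side is the same bound with 1 - p = (n + 1 - i)/(n + 1)
   in place of p. *)
have -> : p * (1 - p) = (1 - p) * (1 - (1 - p)) by ring.
rewrite -qE; apply: (probability_hits_ge iidX) => //; first by lia.
rewrite fine_law_ray_gt qE.
have := incr (Q p); rewrite FQ.
have Fq_ge : p <= F (Q p + e).
  by rewrite -[leLHS]FQ ltW// F_increasing// ltrDl.
have : 8 * s * (p * (1 - p)) <= 8 * s * (F (Q p + e) * (1 - p)).
  by rewrite ler_wpM2l// ler_wpM2r// subr_ge0 ltW.
rewrite -/p; lra.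
Qed.

End deviation.

(** * From each fixed accuracy to a vanishing rate *)

(** Take delta n good and within 1/(n + 1) of the infimum of the positive good values; the slack is
    there because the infimum need not be attained. Each e > 0 is eventually good, so these infima
    tend to 0. *)
Lemma diagonal_rate (R : realType) (good : nat -> R -> Prop) :
    (forall n, good n 1) ->
    (forall e, 0 < e -> \forall n \near \oo, good n e) ->
  exists delta : nat -> R, delta @ \oo --> 0 /\ forall n, good n (delta n).
Proof.
move=> good1 good_near.
pose S n := [set e : R | 0 < e /\ good n e].
have S_inf n : has_inf (S n).
  by split; [exists 1; split | exists 0 => e [/ltW]].
have /choice[delta deltaP] : forall n, exists e : R,
    S n e /\ e < inf (S n) + n.+1%:R^-1.
  move=> n; have n_gt0 : 0 < n.+1%:R^-1 :> R by rewrite invr_gt0.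
  by have [e Se e_lt] := inf_adherent n_gt0 (S_inf n); exists e.
exists delta; split; last by move=> n; have [[]] := deltaP n.
apply/cvgrPdist_le => e e_gt0.
have e2_gt0 : 0 < e / 2 by rewrite divr_gt0.
near=> n.
have [[delta_gt0 _] delta_lt] := deltaP n.
rewrite sub0r normrN gtr0_norm// ltW//; apply: lt_le_trans delta_lt _.
rewrite [leRHS]splitr lerD//.
  apply: ge_inf; first by case: (S_inf n).
  by split => //; near: n; exact: good_near.
by apply/ltW; near: n; exact: (near_infty_natSinv_lt (PosNum e2_gt0)).
Unshelve. all: by end_near. Qed.

(** * Union bound over all indices in the range *)

Section uniform_deviation.
Context (R : realType) (mu : probability R R).
Local Notation F := (law_cdf mu).
Local Notation Q := (law_quantile mu).

Hypothesis F_continuous : continuous F.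
Hypothesis F_increasing : {homo F : s t / s < t}.

(** Probability space and sample are quantified inside, so that a value e chosen for n serves all
    samples of size n at once. *)
Definition deviation_bound (omega : nat -> nat) (n : nat) (e : R) : Prop :=
  forall (d : measure_display) (T : measurableType d) (P : probability T R)
    (X : 'I_n -> {RV P >-> R}), iid_sample mu X ->
  ((1 - e)%:E <=
    P [set w | ereal_sup
         [set `|order_stat (fun j => X j w) i - Q (i%:R / n.+1%:R)|%:E
           | i in [set i | (omega n <= i <= n - omega n)%N]] <= e%:E])%E.

Lemma deviation_bound1 (omega : nat -> nat) (n : nat) : deviation_bound omega n 1.
Proof. by move=> d T P X _; rewrite subrr measure_ge0. Qed.

(** The union bound sums to at most 4 r^(omega n) / (1 - r), which tends to 0 as omega n tends to
    infinity. *)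
Lemma deviation_bound_near (omega : nat -> nat) (e s : R) :
    (forall n, (0 < n)%N -> (0 < omega n)%N) -> omega @ \oo --> \oo ->
    0 < e -> 0 < s <= 1 / 2 ->
    (forall t, 8 * s * (F (t + e) * (1 - F t)) <= F (t + e) - F t) ->
  \forall n \near \oo, deviation_bound omega n e.
Proof.
move=> omega_gt0 omega_oo e_gt0 s01 incr.
pose r := expR (- (s ^+ 2 / 2)).
have s2_gt0 : 0 < s ^+ 2 by rewrite exprn_gt0//; case/andP: s01.
have r01 : 0 <= r < 1.
  by rewrite expR_ge0 expR_lt1 oppr_lt0 divr_gt0.
have [r_ge0 r_lt1] := andP r01.
(* The 4 counts two sides of deviation times two geometric series. *)
have geo_near : \forall n \near \oo, 4 / (1 - r) * r ^+ omega n <= e.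
  have geo0 : geometric (4 / (1 - r)) r k @[k --> \oo] --> 0.
    by apply: cvg_geometric; rewrite ger0_norm.
  have /cvgrPdist_le /(_ _ e_gt0) := cvg_comp _ _ omega_oo geo0.
  apply: filterS => n; rewrite sub0r normrN /= => le_e.
  by apply: le_trans le_e; exact: ler_norm.
near=> n => d T P X iidX.
have n_gt0 : (0 < n)%N by near: n; exact: nbhs_infty_gt.
have a_gt0 := omega_gt0 n n_gt0; set a := omega n in a_gt0 *.
have mD i : measurable (deviation_event mu X e i).
  exact: measurable_deviation_event.
rewrite deviation_eventE// probability_setC; last exact: bigsetU_measurable.
rewrite EFinB leeB//.
apply: (le_trans (probability_bigsetU_le P _ _ mD)).
have r_le i : (a <= i < (n - a).+1)%N ->
    (P (deviation_event mu X e i) <= (2 * (r ^+ i + r ^+ (n.+1 - i)))%:E)%E.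
  move=> /andP[ai ia]; have i_range : (0 < i <= n)%N by lia.
  apply: (le_trans (probability_deviation_event F_continuous F_increasing
    iidX _ e_gt0 s01 incr)) => //.
  by rewrite lee_fin ler_pM2l//; apply: expR_variance_le; [exact: ltW | lia].
rewrite big_nat; apply: (le_trans (lee_sum _ r_le)).
rewrite -big_nat sumEFin lee_fin -mulr_sumr big_split/=.
have sum1 := sum_geometric_le a (n - a).+1 r01.
have sum2 : \sum_(a <= i < (n - a).+1) r ^+ (n.+1 - i) <= r ^+ a / (1 - r).
  (* Reversal sends i to n - i, so the exponent n + 1 - i becomes i + 1, and r^(i + 1) <= r^i. *)
  apply: le_trans sum1; rewrite big_nat_rev/=; apply: ler_sum_nat => i i_range.
  by rewrite ler_wiXn2l// ?ltW//; lia.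
have : 4 / (1 - r) * r ^+ a <= e by rewrite /a; near: n; exact: geo_near.
rewrite mulrAC -mulrA; lra.
Unshelve. all: by end_near. Qed.

End uniform_deviation.

Theorem theorem2 (R : realType) (mu : probability R R)
    (F_continuous : continuous (law_cdf mu))
    (F_increasing : {homo law_cdf mu : s t / s < t})
    (right_tail : forall eps : R, 0 < eps ->
      (limf_esup (fun t : R =>
         ((1 - law_cdf mu (t + eps)) / (1 - law_cdf mu t))%:E) +oo%R < 1)%E)
    (left_tail : forall eps : R, 0 < eps ->
      (limf_esup (fun t : R =>
         (law_cdf mu t / law_cdf mu (t + eps))%:E) -oo%R < 1)%E)
    (omega : nat -> nat)
    (omega_pos : forall n : nat, (0 < n)%N -> (0 < omega n)%N)
    (omega_infty : omega @ \oo --> \oo) :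
  exists delta : nat -> R, delta @ \oo --> 0 /\
    forall n : nat, (0 < n)%N ->
    forall (d : measure_display) (T : measurableType d) (P : probability T R)
      (X : 'I_n -> {RV P >-> R}), iid_sample mu X ->
      ((1 - delta n)%:E <=
        P [set w | ereal_sup
             [set `|order_stat (fun j => X j w) i
                    - law_quantile mu (i%:R / n.+1%:R)|%:E
               | i in [set i | (omega n <= i <= n - omega n)%N]]
           <= (delta n)%:E])%E.
Proof.
have [||delta [delta0 deltaP]] := @diagonal_rate _ (deviation_bound mu omega).
- exact: deviation_bound1.
- move=> e e_gt0.
  have [k k_gt0 kP] := law_cdf_increment F_continuous F_increasing e_gt0
    (right_tail e e_gt0) (left_tail e e_gt0).
  (* The first bound turns k into the constant 8 s of the tail estimate; the second keeps s in the
     range where that estimate holds. *)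
  pose s := Num.min (k / 8) (1 / 2).
  have s_le : 8 * s <= k by rewrite mulrC -ler_pdivlMr// ge_min lexx.
  apply: (@deviation_bound_near _ _ F_continuous F_increasing omega e s) => //.
    by rewrite lt_min ge_min lexx orbT andbT !divr_gt0.
  move=> t; apply: le_trans (kP t); rewrite ler_wpM2r// mulr_ge0//.
    exact: law_cdf_ge0.
  by rewrite subr_ge0 law_cdf_le1.
- by exists delta; split => // n _ d T P X; exact: deltaP.
Qed.
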